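(* Let $X$ be a $\mathrm{CAT}(0)$ cube complex of finite dimension $d$ and finite staircase length $\sigma$, with vertex set $V$, and let $\Gamma$ be a group acting on $X$ by combinatorial automorphisms. Let $l\in\mathbb{N}$, $l\geq 1$, and let $s$ be an $\mathcal{H}$-segment of length $l$ in $X$. Then $\delta^1 f_s\colon V^3\to\mathbb{R}$, $(x,y,z)\mapsto f_s(y,z)-f_s(x,z)+f_s(x,y)$, is bounded. More precisely, $$\|\delta^1 f_s\|_\infty\leq 3(l-1)\,\sigma\, d^l.$$
   Context: Halfspaces: let $D$ be the combinatorial path metric on the vertex set $V$ in the $1$-skeleton of $X$. For an edge $e$ with endpoints $a,b$, $V$ is the disjoint union of $\{v: D(v,a)<D(v,b)\}$ and $\{v: D(v,b)<D(v,a)\}$; each of these two sets is called a halfspace. Write $\overline h:=V\setminus h$. For $x,y\in V$, $[x,y]_{\mathcal{H}}$ is the (finite) set of halfspaces $h$ with $y\in h$ and $x\in\overline h$. Two halfspaces $h,k$ are transverse ($h\pitchfork k$) if $h\cap k,\ \overline h\cap k,\ h\cap\overline k,\ \overline h\cap\overline k$ are all non-empty. The dimension of $X$ is the highest dimension of a cube in $X$. A length-$\sigma$ staircase is a pair $(a_1\supset\cdots\supset a_\sigma,\ b_1\supset\cdots\supset b_\sigma)$ of properly decreasing chains of halfspaces with $a_i\pitchfork b_j$ for all $1\le j<i\le\sigma$ and $a_i\supsetneq b_i$ for all $i$. The staircase length of $X$ is the maximal length of a staircase in $X$ (or $\infty$). Halfspaces $h\supset k$ are tightly nested if they are distinct and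 there is no halfspace $h'\ne h,k$ with $h\supset h'\supset k$. An $\mathcal{H}$-segment of length $l\ge1$ is a sequence $s=(h_1\supset\cdots\supset h_l)$ of halfspaces with consecutive ones tightly nested. $\Gamma$ acts on $\mathcal{H}$-segments; elements of $\Gamma s$ are called translates of $s$. A segment is contained in $[x,y]_{\mathcal{H}}$ if all its halfspaces are. The function $f_s\colon V\times V\to\mathbb{R}$ is defined by letting $f_s(x,y)$ be the number of translates of $s$ contained in $[x,y]_{\mathcal{H}}$ minus the number of translates of $s$ contained in $[y,x]_{\mathcal{H}}$. *)

(* Defs.v *)
From HB Require Import structures.
From mathcomp Require Import all_boot all_order all_algebra finmap.
From mathcomp Require Import all_classical reals ereal normedtype.

Set Implicit Arguments.
Unset Strict Implicit.
Unset Printing Implicit Defensive.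

Import Order.TTheory GRing.Theory Num.Theory.
Local Open Scope classical_set_scope.
Local Open Scope ring_scope.

(* Vertices of the standard cube [0,1]^n. *)
Definition Q (n : nat) : Type := {ffun 'I_n -> bool}.

Definition origin (n : nat) : Q n := [ffun=> false].
Definition axis (n : nat) (i : 'I_n) : Q n := [ffun j => j == i].
Definition corner2 (s t : bool) : Q 2 := [ffun i => if i == ord0 then s else t].

Definition hamming (n : nat) (x y : Q n) : nat := #|[pred i | x i != y i]|.

(* The Hamming-isometric embeddings Q m -> Q n are exactly the isometries of
   [0,1]^m onto the m-dimensional faces of [0,1]^n, restricted to vertices. *)
Definition face_map (m n : nat) (f : Q m -> Q n) : Prop :=
  forall x y, hamming (f x) (f y) = hamming x y.

(* Cubical complexes in the sense of Bridson-Haefliger, Definition I.7.32, in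
   combinatorial form.  An n-cube is given by its characteristic map restricted
   to vertices, so each geometric cube occurs once for every isometric
   parametrization.  By [cube_meet], two cubes that meet do so in exactly one
   common face, so a cell is determined by its vertices and combinatorial
   automorphisms can be described by their action on vertices. *)
Record cube_complex : Type := CubeComplex {
  vertex :> Type;
  cube : forall n : nat, (Q n -> vertex) -> Prop;
  cube_vertex : forall v : vertex, @cube 0 (fun=> v);
  cube_inj : forall n (c : Q n -> vertex), cube c -> injective c;
  cube_face : forall m n (c : Q n -> vertex) (f : Q m -> Q n),
    cube c -> face_map f -> cube (c \o f);
  cube_meet : forall m n (c : Q m -> vertex) (c' : Q n -> vertex),
    cube c -> cube c' -> (exists x y, c x = c' y) ->
    exists k (f : Q k -> Q m) (g : Q k -> Q n),
      [/\ face_map f, face_map g, c \o f = c' \o g &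
          forall x y, c x = c' y -> exists2 z, x = f z & y = g z]
}.
Arguments cube {_ _} _.

Section CubeComplex.
Variable X : cube_complex.
Implicit Types (v x y z : X) (p q : seq X) (h k : set X).

Definition edge (a b : X) : Prop :=
  exists2 c : Q 1 -> X, cube c & c [ffun=> false] = a /\ c [ffun=> true] = b.

(* [a], [b], [c], [d] are listed in cyclic order. *)
Definition square (a b c d : X) : Prop :=
  exists2 s : Q 2 -> X, cube s &
    [/\ s (corner2 false false) = a, s (corner2 true false) = b,
        s (corner2 true true) = c & s (corner2 false true) = d].

(* [p] lists the vertices of the path after its starting point [x], so the
   length of the path is [size p]. *)
Fixpoint edge_path x p y : Prop :=
  if p is z :: p' then edge x z /\ edge_path z p' y else x = y.

(* Homotopy of edge paths (full vertex lists) relative to endpoints in the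
   2-skeleton. *)
Inductive homotopic : seq X -> seq X -> Prop :=
| homotopic_refl p : homotopic p p
| homotopic_sym p q : homotopic p q -> homotopic q p
| homotopic_trans p q r : homotopic p q -> homotopic q r -> homotopic p r
| homotopic_backtrack p q a b : edge a b ->
    homotopic (p ++ [:: a, b, a & q]) (p ++ a :: q)
| homotopic_square p q a b c d : square a b c d ->
    homotopic (p ++ [:: a, b, c & q]) (p ++ [:: a, d, c & q]).

Definition connected : Prop := forall x y, exists p, edge_path x p y.

(* Triviality of the edge-path group, which is the fundamental group of the
   geometric realization. *)
Definition simply_connected : Prop :=
  connected /\ forall x p, edge_path x p x -> homotopic (x :: p) [:: x].

(* The vertices of the link of [v] are the edges at [v], represented by their
   other endpoints; the corner at [v] of an n-cube is a simplex on n vertices. *)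
Definition link_simplex v (n : nat) (w : 'I_n -> X) : Prop :=
  exists2 c : Q n -> X, cube c & c (origin n) = v /\ forall i, c (axis i) = w i.

Definition link_vertex v (a : X) : Prop := link_simplex v (fun _ : 'I_1 => a).

Definition link_adjacent v (a b : X) : Prop :=
  link_simplex v (fun i : 'I_2 => if i == ord0 then a else b).

Definition flag_links : Prop :=
  forall v (n : nat) (w : 'I_n -> X),
    (forall i, link_vertex v (w i)) ->
    (forall i j : 'I_n, i != j -> link_adjacent v (w i) (w j)) ->
    link_simplex v w.

Definition CAT0 : Prop := simply_connected /\ flag_links.

Definition has_dimension (d : nat) : Prop :=
  (exists c : Q d -> X, cube c) /\
  forall n (c : Q n -> X), cube c -> (n <= d)%N.

(* The combinatorial path metric; the default value 0 is only used when there
   is no edge path from [x] to [y]. *)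
Definition dist x y : nat :=
  xget 0%N [set n | (exists2 p, edge_path x p y & size p = n) /\
                    forall p, edge_path x p y -> (n <= size p)%N].

Definition halfspace h : Prop :=
  exists a b, edge a b /\ h = [set v | (dist v a < dist v b)%N].

Definition interval x y : set (set X) :=
  [set h | [/\ halfspace h, h y & (~` h) x]].

Definition transverse h k : Prop :=
  [/\ h `&` k !=set0, ~` h `&` k !=set0,
      h `&` ~` k !=set0 & ~` h `&` ~` k !=set0].

(* Indices are shifted to start at 0. *)
Definition staircase (n : nat) (a b : 'I_n -> set X) : Prop :=
  [/\ forall i, halfspace (a i) /\ halfspace (b i),
      forall i j : 'I_n, (i < j)%N -> a j `<` a i /\ b j `<` b i,
      forall i j : 'I_n, (j < i)%N -> transverse (a i) (b j) &
      forall i, b i `<` a i].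

(* The empty staircase has length 0, so the staircase length is 0 when there
   are no properly nested halfspaces. *)
Definition has_staircase_length (m : nat) : Prop :=
  (exists a b : 'I_m -> set X, staircase a b) /\
  forall n (a b : 'I_n -> set X), staircase a b -> (n <= m)%N.

Definition tightly_nested h k : Prop :=
  k `<` h /\
  forall h', halfspace h' -> k `<=` h' -> h' `<=` h -> h' = h \/ h' = k.

Definition Hsegment (l : nat) (s : l.-tuple (set X)) : Prop :=
  (forall i, halfspace (tnth s i)) /\
  forall i j : 'I_l, j = i.+1 :> nat -> tightly_nested (tnth s i) (tnth s j).

Section Action.
Variables (Gamma : groupType) (act : Gamma -> X -> X).

Definition acts_by_automorphisms : Prop :=
  [/\ forall v, act 1%g v = v,
      forall g g' v, act (g * g')%g v = act g (act g' v) &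
      forall g n (c : Q n -> X), cube c -> cube (act g \o c)].

Definition translate (l : nat) (g : Gamma) (s : l.-tuple (set X)) :
    l.-tuple (set X) :=
  [tuple of [seq act g @` h | h <- s]].

Definition translates_in (l : nat) (s : l.-tuple (set X)) x y :
    set (l.-tuple (set X)) :=
  [set t | (exists g, t = translate g s) /\
           forall i, interval x y (tnth t i)].

(* [translates_in] is finite because intervals are, so the junk value of
   [fset_set] at infinite sets plays no role. *)
Definition fseg (R : realType) (l : nat) (s : l.-tuple (set X)) x y : R :=
  (#|` fset_set (translates_in s x y)|)%:R
  - (#|` fset_set (translates_in s y x)|)%:R.

End Action.
End CubeComplex.

Definition delta1 (R : realType) (V : Type) (f : V -> V -> R)
    (t : V * V * V) : R :=
  let: (x, y, z) := t in f y z - f x z + f x y.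

Definition supnorm (R : realType) (T : Type) (g : T -> R) : \bar R :=
  ereal_sup [set `|g t|%:E | t in [set: T]].

(* Main.v *)
(* Let x, y, z be vertices.  Splitting [x,y]_H into the halfspaces that contain
   z and those that do not (no median vertex is needed), every translate of s
   that stays on one side of the split cancels in delta^1 f_s.
   What remains are the translates in which some consecutive tightly nested
   pair a, b satisfies z \in a and z \notin b.  Antichains in [x,y]_H consist of
   pairwise transverse halfspaces, so they have at most d elements; chains of
   such pairs are staircases, so they have at most sigma elements.  Hence there
   are at most sigma d^2 such pairs, the pair can occur at l - 1 positions, and
   each of the other l - 2 halfspaces can be chosen in at most d ways.

   The facts about CAT(0) cube complexes come from a normal form for edge
   paths, as in Tits' solution of the word problem for right-angled Coxeter
   groups: an edge path is reduced if square moves never produce a backtrack,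
   and by simple connectedness and the link condition, reduced paths with the
   same endpoints differ by square moves only.  So reduced paths are geodesics,
   and two edges at v that both start geodesics towards y span a square. *)
Require Import Defs.
From mathcomp Require Import zify lra.
From mathcomp Require Import all_boot all_order all_algebra finmap.
From mathcomp Require Import all_classical reals ereal normedtype.
Import Order.TTheory GRing.Theory Num.Theory.
Import numFieldNormedType.Exports.
Local Open Scope ring_scope.

Set Implicit Arguments.
Unset Strict Implicit.
Unset Printing Implicit Defensive.

Local Open Scope classical_set_scope.

(** * Squares and cubes *)

Lemma hammingE n (x y : Q n) : hamming x y = (\sum_(i < n) (x i != y i))%N.
Proof.
rewrite /hamming -sum1_card big_mkcond; apply: eq_bigr => i _.
by case: ifP; rewrite inE => ->.
Qed.

Definition corner3 (s t r : bool) : Q 3 :=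
  [ffun i : 'I_3 => if i == ord0 then s else if i == ord_max then r else t].

Lemma hamming_corner2 s t s' t' :
  hamming (corner2 s t) (corner2 s' t') = ((s != s') + (t != t'))%N.
Proof. by rewrite hammingE !big_ord_recl big_ord0 !ffunE /= addn0. Qed.

Lemma hamming_corner3 s t r s' t' r' :
  hamming (corner3 s t r) (corner3 s' t' r')
    = ((s != s') + (t != t') + (r != r'))%N.
Proof. by rewrite hammingE !big_ord_recl big_ord0 !ffunE /= addn0 addnA. Qed.

Lemma corner2E (x : Q 2) : x = corner2 (x ord0) (x ord_max).
Proof.
apply/ffunP => -[[|[|i]] // Hi]; rewrite ffunE; congr (x _); exact: val_inj.
Qed.

Section Cubes.
Variable X : cube_complex.
Implicit Types (a b c u v x y z : X) (p q r : seq X).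

(** Precomposing [k] with the Hamming isometry given by [f] restricts it to a two-dimensional
    face. *)
Lemma cube_square n (k : Q n -> X) (f : bool -> bool -> Q n) : cube k ->
  (forall s t s' t', hamming (f s t) (f s' t') = ((s != s') + (t != t'))%N) ->
  square (k (f false false)) (k (f true false))
         (k (f true true)) (k (f false true)).
Proof.
move=> kc fH; exists (k \o (fun x : Q 2 => f (x ord0) (x ord_max))).
  apply: cube_face kc _ => x y.
  by rewrite fH (corner2E x) (corner2E y) hamming_corner2 !ffunE.
by rewrite /= !ffunE /=.
Qed.

Lemma square_rot a b c d : square a b c d -> square b c d a.
Proof.
move=> [k kc [<- <- <- <-]].
apply: (@cube_square _ k (fun s t => corner2 (~~ t) s)) => // s t s' t'.
by rewrite hamming_corner2 addnC; case: s s' t t' => -[] [] [].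
Qed.

Lemma square_flip a b c d : square a b c d -> square a d c b.
Proof.
move=> [k kc [<- <- <- <-]].
apply: (@cube_square _ k (fun s t => corner2 t s)) => // s t s' t'.
by rewrite hamming_corner2 addnC.
Qed.

Lemma corner2_inj s t s' t' : corner2 s t = corner2 s' t' -> s = s' /\ t = t'.
Proof.
by move=> /ffunP e; move: (e ord0) (e ord_max); rewrite !ffunE.
Qed.

Lemma square_neq a b c d : square a b c d -> a <> c /\ b <> d.
Proof.
by move=> [k kc [<- <- <- <-]]; split=> /(cube_inj kc) /corner2_inj[].
Qed.

Lemma square_edge a b c d : square a b c d -> edge a b.
Proof.
move=> [k kc [<- <- _ _]].
exists (k \o (fun x : Q 1 => corner2 (x ord0) false)).
  apply: cube_face kc _ => x y.
  by rewrite hamming_corner2 hammingE big_ord_recl big_ord0.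
by rewrite /= !ffunE.
Qed.

Lemma edge_sym a b : edge a b -> edge b a.
Proof.
move=> [k kc [<- <-]].
exists (k \o (fun x : Q 1 => [ffun=> ~~ x ord0])).
  apply: cube_face kc _ => x y.
  rewrite !hammingE !big_ord_recl !big_ord0 !ffunE.
  by case: (x ord0) (y ord0) => -[].
by rewrite /= !ffunE.
Qed.

(* The fourth corner of a square is found from three consecutive corners in
   any cube as the coordinatewise sum modulo 2, and this determines it. *)
Lemma square_uniq a b c c' d : square a b c d -> square a b c' d -> c = c'.
Proof.
move=> [k kc [ka kb kcc kd]] [k' kc' [ka' kb' kcc' kd']].
have [|n [f [g [fH gH e meet]]]] := cube_meet kc kc'.
  by exists (corner2 false false), (corner2 false false); rewrite ka ka'.
have [|z0 f0 g0] := meet (corner2 false false) (corner2 false false).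
  by rewrite ka ka'.
have [|z1 f1 g1] := meet (corner2 true false) (corner2 true false).
  by rewrite kb kb'.
have [|z2 f2 g2] := meet (corner2 false true) (corner2 false true).
  by rewrite kd kd'.
pose z3 : Q n := [ffun i => z0 i (+) (z1 i (+) z2 i)].
have h1 : hamming z3 z1 = hamming z0 z2.
  rewrite !hammingE; apply: eq_bigr => i _; rewrite ffunE.
  by case: (z0 i) (z1 i) (z2 i) => -[] [].
have h2 : hamming z3 z2 = hamming z0 z1.
  rewrite !hammingE; apply: eq_bigr => i _; rewrite ffunE.
  by case: (z0 i) (z1 i) (z2 i) => -[] [].
have h0 : hamming z3 z0 = hamming z1 z2.
  rewrite !hammingE; apply: eq_bigr => i _; rewrite ffunE.
  by case: (z0 i) (z1 i) (z2 i) => -[] [].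
have corner w : hamming w (corner2 true false) = 1%N ->
    hamming w (corner2 false true) = 1%N ->
    hamming w (corner2 false false) = 2%N -> w = corner2 true true.
  by rewrite (corner2E w) !hamming_corner2; case: (w ord0) (w ord_max) => -[].
have fz : f z3 = corner2 true true.
  by apply: corner; rewrite (f0, f1, f2) fH (h0, h1, h2) -fH -?f0 -?f1 -?f2
                            hamming_corner2.
have gz : g z3 = corner2 true true.
  by apply: corner; rewrite (g0, g1, g2) gH (h0, h1, h2) -gH -?g0 -?g1 -?g2
                            hamming_corner2.
by rewrite -kcc -kcc' -{1}fz -gz; apply: (congr1 (fun F => F z3) e).
Qed.

Lemma square_link_adjacent v a b c :
  square v a c b -> link_adjacent v a b.
Proof.
move=> [k kc [k0 ka _ kb]]; exists k => //; split=> [|i].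
  by rewrite -k0; congr k; apply/ffunP => i; rewrite !ffunE; case: ifP.
case: i => -[|[|i]] // Hi /=; [rewrite -ka | rewrite -kb]; congr k;
  apply/ffunP => -[[|[|j]] // Hj]; by rewrite !ffunE.
Qed.

Lemma edge_link_vertex v a : edge v a -> link_vertex v a.
Proof.
move=> [k kc [<- <-]]; exists k => //; split=> [|i]; congr k.
apply/ffunP => j; rewrite !ffunE; by rewrite (ord1 i) (ord1 j) eqxx.
Qed.

Hypothesis flag : flag_links X.

(** The neighbours [v], [d], [e] of [b] are pairwise adjacent in its link, so flagness fills in a
    3-cube at [b]. By [square_uniq] its vertices include [a], [c] and [f], and [g] is the vertex
    opposite to [b]. *)
Lemma cube_condition b v d e a c f :
  square b v a d -> square b v c e -> square b d f e -> a <> c ->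
  exists g, [/\ square v a g c, square a d f g & square c e f g].
Proof.
move=> sa sc sf ac.
have [k kc [k0 kE]] : link_simplex b
    (fun i : 'I_3 => if i == ord0 then v else if i == ord_max then e else d).
  apply: flag => [i|i j].
    case: ifP => _; first exact/edge_link_vertex/(square_edge sa).
    case: ifP => _; apply: edge_link_vertex.
      exact: square_edge (square_flip sf).
    exact: square_edge sf.
  case: i => -[|[|[|i]]] // Hi; case: j => -[|[|[|j]]] // Hj;
    rewrite -val_eqE //= => _.
  - exact: square_link_adjacent sa.
  - exact: square_link_adjacent sc.
  - exact: square_link_adjacent (square_flip sa).
  - exact: square_link_adjacent sf.
  - exact: square_link_adjacent (square_flip sc).
  - exact: square_link_adjacent (square_flip sf).
pose K (s t r : bool) := k (corner3 s t r).
have K0 : K false false false = b.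
  by rewrite -k0; congr k; apply/ffunP => i; rewrite !ffunE; do 2?case: ifP.
have Kax : [/\ K true false false = v, K false true false = d &
               K false false true = e].
  split; [move: (kE ord0)|move: (kE (@Ordinal 3 1 isT))|move: (kE ord_max)];
    rewrite /= => <-; congr k; apply/ffunP => -[[|[|[|i]]] // Hi];
    by rewrite !ffunE.
case: Kax => Kv Kd Ke.
pose S F := @cube_square 3 k F kc.
have H3 := hamming_corner3.
have Ka : K true true false = a.
  apply: (@square_uniq b v _ _ d) sa; rewrite -K0 -Kv -Kd.
  by apply: (S (fun s t => corner3 s t false)) => *; rewrite H3 addn0.
have Kc : K true false true = c.
  apply: (@square_uniq b v _ _ e) sc; rewrite -K0 -Kv -Ke.
  by apply: (S (fun s t => corner3 s false t)) => *; rewrite H3 addn0.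
have Kf : K false true true = f.
  apply: (@square_uniq b d _ _ e) sf; rewrite -K0 -Kd -Ke.
  by apply: (S (fun s t => corner3 false s t)) => *; rewrite H3.
exists (K true true true); rewrite -Kv -Ka -Kc -Kd -Kf -Ke; split.
- by apply: (S (fun s t => corner3 true s t)) => *; rewrite H3.
- apply: (S (fun s t => corner3 (~~ s) true t)) => s t s' t'.
  by rewrite H3 addn0; case: s s' => -[].
- apply: (S (fun s t => corner3 (~~ s) t true)) => s t s' t'.
  by rewrite H3 addn0; case: s s' => -[].
Qed.

End Cubes.

(** * Reduced edge paths *)

Section Paths.
Variable X : cube_complex.
Implicit Types (a b c u v x y z : X) (p q r s : seq X).

(* Equality of paths up to square moves, in the form of Levi's lemma: if the
   first steps [a] and [b] differ, they span a square at [u] whose fourth vertex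
   [c] can be visited next from both. *)
Inductive path_equiv : X -> seq X -> seq X -> Prop :=
| path_equiv_nil u : path_equiv u [::] [::]
| path_equiv_cons u a p q :
    path_equiv a p q -> path_equiv u (a :: p) (a :: q)
| path_equiv_square u a b c p q r : square u a c b ->
    path_equiv a p (c :: r) -> path_equiv b q (c :: r) ->
    path_equiv u (a :: p) (b :: q).

Lemma path_equiv_refl u p : path_equiv u p p.
Proof. by elim: p u => *; constructor. Qed.
Hint Resolve path_equiv_refl : core.

Lemma path_equiv_sym u p q : path_equiv u p q -> path_equiv u q p.
Proof.
elim=> {u p q} [u|u a p q _|u a b c p q r sq pr _ qr _]; try by constructor.
exact: path_equiv_square (square_flip sq) qr pr.
Qed.

Lemma path_equiv_size u p q : path_equiv u p q -> size p = size q.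
Proof.
by elim=> {u p q} //= [u a p q _ ->|u a b c p q r _ _ -> _ ->].
Qed.

Lemma path_equiv_swap u a b c p : square u a c b ->
  path_equiv u (a :: c :: p) (b :: c :: p).
Proof. by move=> sq; apply: path_equiv_square sq _ _. Qed.

Lemma path_equiv_consP u a b p q : path_equiv u (a :: p) (b :: q) ->
  (a = b /\ path_equiv a p q) \/
  (a <> b /\ exists c r,
     [/\ square u a c b, path_equiv a p (c :: r) & path_equiv b q (c :: r)]).
Proof.
move E1: (a :: p) => l1; move E2: (b :: q) => l2 e.
case: e E1 E2 => {u l1 l2} // [u a' p' q' e|u a' b' c p' q' r sq e1 e2]
  [-> ->] [-> ->]; first by left.
by right; split; [case: (square_neq sq)|exists c, r].
Qed.

Lemma path_equiv_cancel u a p q :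
  path_equiv u (a :: p) (a :: q) -> path_equiv a p q.
Proof. by case/path_equiv_consP => [[]|[]]. Qed.

Lemma path_equiv_edge u p q y :
  path_equiv u p q -> edge_path u p y <-> edge_path u q y.
Proof.
elim=> {u p q} // [u a p q _ IH|u a b c p q r sq _ IHp _ IHq] /=.
  by split=> -[? /IH].
rewrite IHp IHq /=.
by split=> -[_ [_ ?]]; split; try split=> //;
  [apply: square_edge (square_flip sq)|
   apply: square_edge (square_rot (square_flip sq))|
   apply: square_edge sq|apply: square_edge (square_rot sq)].
Qed.

Hypothesis flag : flag_links X.

(* In the main case the first steps [a], [b], [c] are distinct: the squares at
   [u] spanned by [a, b] and by [b, c], together with the square at [b] that
   the induction hypothesis provides, are three faces of a cube at [b]. *)
Lemma path_equiv_trans u p q r :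
  path_equiv u p q -> path_equiv u q r -> path_equiv u p r.
Proof.
have [n] := ubnP (size q); elim: n u p q r => // n IHn u p q r.
case: q => [|b q] /= sz e1 e2.
  by have := path_equiv_size e1; case: p e1.
have {IHn}tr v l1 l2 l3 : size l2 = size q -> path_equiv v l1 l2 ->
    path_equiv v l2 l3 -> path_equiv v l1 l3 by move=> e; apply: IHn; rewrite e.
have := path_equiv_size e1; case: p e1 => // a p e1 [szp].
have := path_equiv_size e2; case: r e2 => // c r e2 [szr].
case: (path_equiv_consP e1) => [[eab {}e1]|[ab [d [p' [sd pd qd]]]]].
  subst b; case: (path_equiv_consP e2) => [[<- {}e2]|[ac [k [t [sk qk rk]]]]].
    by constructor; apply: tr e1 e2.
  exact: path_equiv_square sk (tr _ _ _ _ erefl e1 qk) rk.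
case: (path_equiv_consP e2) => [[ebc {}e2]|[bc [e [q' [se qe re]]]]].
  subst c; apply: path_equiv_square sd pd _.
  exact: tr erefl (path_equiv_sym e2) qd.
have de : path_equiv b (d :: p') (e :: q').
  exact: tr erefl (path_equiv_sym qd) qe.
have szd := path_equiv_size qd; have sze := path_equiv_size qe.
have sa := square_rot (square_rot (square_rot sd)).
have sc := square_flip (square_rot se).
case: (path_equiv_consP de) => [[ede {}de]|[ne [f [t [sf df ef]]]]].
  (* If [d = e], the squares [sa] and [sc] share three consecutive corners, which forces [a = c]. *)
  subst e; have ac := square_uniq sa sc; subst c; constructor.
  apply: (tr _ _ (d :: p')) => //.
  by apply: (tr _ _ (d :: q')) (path_equiv_sym re) => //; constructor.
have ac : a <> c.
  by move=> eac; subst c; apply: ne; apply: square_uniq sd (square_flip se).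
have [g [sg sag scg]] := cube_condition flag sa sc sf ac.
apply: path_equiv_square sg _ _.
- apply: (tr _ _ (d :: p')) => //.
  apply: (tr _ _ (d :: f :: t)) (path_equiv_swap _ sag).
    by rewrite szd /= (path_equiv_size df).
  by constructor.
- apply: (tr _ _ (e :: q')) => //.
  apply: (tr _ _ (e :: f :: t)) (path_equiv_swap _ scg).
    by rewrite sze /= (path_equiv_size ef).
  by constructor.
Qed.

(** Each suffix is tested only at its first edge, but up to square moves of what follows. By
    [reduced_equiv] this excludes every backtrack that square moves can produce. *)
Fixpoint reduced u p : Prop :=
  if p is a :: p' then reduced a p' /\ forall r, ~ path_equiv a p' (u :: r)
  else True.

(** A backtrack on one side of a square can be carried across it to the parallel edge, where it
    becomes a backtrack of the other path. *)
Lemma reduced_equiv u p q : path_equiv u p q -> reduced u p <-> reduced u q.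
Proof.
have sq_case v a b c s t r : square v a c b -> path_equiv a s (c :: r) ->
    path_equiv b t (c :: r) -> (reduced a s <-> reduced a (c :: r)) ->
    (reduced b t <-> reduced b (c :: r)) ->
    reduced v (a :: s) -> reduced v (b :: t).
  move=> sq e1 e2 i1 i2 [/= /i1 /= [rr nr] np].
  have sq' : square b c a v.
    exact: square_flip (square_rot (square_rot (square_rot sq))).
  split=> [|w /(path_equiv_trans (path_equiv_sym e2)) e].
    apply/i2; split=> // w e; apply: (np (b :: w)).
    apply: path_equiv_trans e1 _.
    apply: path_equiv_trans (path_equiv_swap _ (square_rot sq)).
    by constructor.
  case: (path_equiv_consP e) => [[/esym/(proj1 (square_neq sq))//]|].
  move=> [_ [d [k [sq2 e3 _]]]]; apply: (nr k).
  by rewrite (square_uniq sq' sq2).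
elim=> {u p q} // [u a p q e IH|u a b c p q r sq e1 IH1 e2 IH2].
  by split=> /= -[/IH rp np]; split=> // s e'; apply: (np s);
    apply: path_equiv_trans e'; rewrite //; apply: path_equiv_sym.
split; first exact: sq_case sq e1 e2 IH1 IH2.
exact: sq_case (square_flip sq) e2 e1 IH2 IH1.
Qed.

(* The action of the edge from [u] to [v] on reduced paths from [v], after van
   der Waerden's proof of the normal form theorem for free products. *)
Definition step u v q : seq X :=
  match pselect (exists r, path_equiv v q (u :: r)) with
  | left e => projT1 (cid e)
  | right _ => v :: q
  end.

Variant step_spec u v q : seq X -> Prop :=
| StepCancel r of path_equiv v q (u :: r) : step_spec u v q r
| StepExtend of (forall r, ~ path_equiv v q (u :: r)) :
    step_spec u v q (v :: q).

Lemma stepP u v q : step_spec u v q (step u v q).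
Proof.
rewrite /step; case: pselect => [e|ne].
  by case: (cid e) => r er /=; constructor.
by constructor=> r er; apply: ne; exists r.
Qed.

Lemma step_cancel u v q r :
  path_equiv v q (u :: r) -> path_equiv u (step u v q) r.
Proof.
move=> e; case: stepP => [r' e'|/(_ r)//].
exact: path_equiv_cancel (path_equiv_trans (path_equiv_sym e') e).
Qed.

Lemma step_extend u v q :
  (forall r, ~ path_equiv v q (u :: r)) -> step u v q = v :: q.
Proof. by move=> ne; case: stepP => // r /ne. Qed.

Lemma step_equiv u v p q :
  path_equiv v p q -> path_equiv u (step u v p) (step u v q).
Proof.
move=> e; case: (stepP u v q) => [r eq|ne].
  exact: step_cancel (path_equiv_trans e eq).
rewrite step_extend; first by constructor.
by move=> r ep; apply: (ne r); apply: path_equiv_trans (path_equiv_sym e) ep.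
Qed.

Lemma step_reduced u v q : reduced v q -> reduced u (step u v q).
Proof. by move=> rq; case: stepP => // r /reduced_equiv/proj1/(_ rq)[]. Qed.

Lemma step_edge_path u v q y :
  edge u v -> edge_path v q y -> edge_path u (step u v q) y.
Proof.
move=> uv pq; case: stepP => // r /path_equiv_edge e.
by case: (proj1 (e y) pq).
Qed.

Lemma step_size u v q : size (step u v q) = (size q).+1 \/
  size q = (size (step u v q)).+1.
Proof. by case: stepP => [r /path_equiv_size ->|_]; [right|left]. Qed.

(** If the first step cancels, reducedness of [q] keeps the second one from cancelling too. *)
Lemma step_back u v q : reduced v q -> path_equiv v (step v u (step u v q)) q.
Proof.
move=> rq; case: (stepP u v q) => [r er|_]; last exact: step_cancel.
have [rr nr] := proj1 (reduced_equiv er) rq.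
by rewrite step_extend //; apply: path_equiv_sym.
Qed.

Lemma step_square u a c b q : square u a c b -> reduced c q ->
  path_equiv u (step u a (step a c q)) (step u b (step b c q)).
Proof.
(* Here [p] can start with [d]. If the remainder [t] can go on to [v], both steps cancel on either
   side of the square; otherwise exactly one does. *)
have half v d e f p t : square v d f e -> reduced f p ->
    path_equiv f p (d :: t) ->
    path_equiv v (step v d (step d f p)) (step v e (step e f p)).
  move=> sq rp ep.
  have sqf : square f d v e := square_flip (square_rot (square_rot sq)).
  have e1 : path_equiv d (step d f p) t by exact: step_cancel.
  have [rt nt] := proj1 (reduced_equiv ep) rp.
  have e2 : path_equiv v (step v d (step d f p)) (step v d t).
    exact: step_equiv.
  apply: path_equiv_trans e2 _.
  case: (stepP v d t) => [w ew|ne].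
    have ep2 : path_equiv f p (e :: v :: w).
      apply: path_equiv_trans ep _.
      apply: path_equiv_trans (path_equiv_swap _ sqf).
      by constructor.
    apply: path_equiv_sym; apply: step_cancel; exact: step_cancel.
  have nee s : ~ path_equiv f p (e :: s).
    move=> es.
    case: (path_equiv_consP (path_equiv_trans (path_equiv_sym ep) es)).
      by case=> /(proj2 (square_neq sq)).
    case=> _ [g [w [sg eg _]]]; apply: (ne w).
    by rewrite (square_uniq sqf sg).
  rewrite (step_extend nee); apply: path_equiv_sym; apply: step_cancel.
  apply: (path_equiv_trans (q := f :: d :: t)); first by constructor.
  apply: path_equiv_swap.
  exact: square_flip (square_rot (square_rot (square_rot sq))).
move=> sq rq.
have [[t et]|na] := pselect (exists t, path_equiv c q (a :: t)).
  exact: half sq rq et.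
have [[t et]|nb] := pselect (exists t, path_equiv c q (b :: t)).
  by apply: path_equiv_sym; apply: half (square_flip sq) rq et.
(* The first step does not cancel. If the second did, uniqueness of the square would make [p] start
   with [e]. *)
have nostart v d e f p : square v d f e ->
    ~ (exists t, path_equiv f p (d :: t)) ->
    ~ (exists t, path_equiv f p (e :: t)) ->
    step v d (step d f p) = d :: f :: p.
  move=> {sq rq} sq nd ne; rewrite (@step_extend d); last first.
    by move=> t et; apply: nd; exists t.
  rewrite step_extend // => t.
  move=> /path_equiv_consP[[/esym/(proj1 (square_neq sq))]|] //.
  case=> _ [g [w [sg eg _]]]; apply: ne; exists w.
  by rewrite (@square_uniq _ d f e g v) //; apply: square_rot.
rewrite (nostart u a b c) // (nostart u b a c) //; last exact: square_flip.
exact: path_equiv_swap.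
Qed.

End Paths.

(** * Walks acting on reduced paths; geodesics and the path metric *)

Section Geodesics.
Variable X : cube_complex.
Implicit Types (a b c u v x y z : X) (p q r s : seq X).
Hypothesis hX : CAT0 X.
Let flag : flag_links X. Proof. exact: proj2 hX. Qed.

(** [L] is the full vertex list of a walk that ends where [q] starts; its edges act on [q] through
    [step], the last edge first. *)
Fixpoint act_walk (L : seq X) q : seq X :=
  if L is u :: L' then
    if L' is v :: _ then step u v (act_walk L' q) else q
  else q.

Lemma act_walk_reduced x0 L q :
  reduced (last x0 L) q -> reduced (head x0 L) (act_walk L q).
Proof.
elim: L => // u [|v L] //= IH /IH rq.
exact: (step_reduced flag).
Qed.

Lemma act_walk_cat x0 p a L L' q :
  path_equiv a (act_walk (a :: L) q) (act_walk (a :: L') q) ->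
  path_equiv (head x0 (p ++ a :: L)) (act_walk (p ++ a :: L) q)
                                     (act_walk (p ++ a :: L') q).
Proof.
move=> e; elim: p => // u [|v p] IH; exact: (step_equiv flag _ IH).
Qed.

(** The two generating moves act trivially: backtracks by [step_back], squares by [step_square]. *)
Lemma homotopic_act x0 L L' : homotopic L L' ->
  [/\ head x0 L = head x0 L', last x0 L = last x0 L' &
      forall q, reduced (last x0 L) q ->
        path_equiv (head x0 L) (act_walk L q) (act_walk L' q)].
Proof.
elim=> {L L'} [p|p q _ [-> -> e]|p q r _ [-> -> e1] _ [<- <- e2]
              |p q a b ab|p q a b c d sq].
- by split=> // q _; apply: path_equiv_refl.
- by split=> // r /e/path_equiv_sym.
- by split=> // s rs; exact: (path_equiv_trans flag (e1 _ rs) (e2 _ rs)).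
- split=> [||r]; rewrite ?last_cat //; first by case: p.
  move=> /= rr; apply: act_walk_cat => /=.
  by apply: (step_back flag); apply: (@act_walk_reduced a (a :: q)).
- split=> [||r]; rewrite ?last_cat //; first by case: p.
  move=> /= rr; apply: act_walk_cat => /=.
  by apply: (step_square flag sq); apply: (@act_walk_reduced c (c :: q)).
Qed.

Lemma act_walk_nil u p : reduced u p -> path_equiv u (act_walk (u :: p) [::]) p.
Proof.
elim: p u => [|v p IH] u /= rp; first exact: path_equiv_nil.
case: rp => /IH {}IH np.
apply: (path_equiv_trans flag (step_equiv flag _ IH) _).
by rewrite step_extend //; apply: path_equiv_refl.
Qed.

Lemma act_walk_edge_path u p q y z :
  edge_path u p y -> edge_path y q z -> edge_path u (act_walk (u :: p) q) z.
Proof.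
elim: p u => [|v p IH] u /=; first by move=> ->.
by move=> [uv /IH {}IH] /IH; apply: step_edge_path.
Qed.

Lemma act_walk_size u p q : (size (act_walk (u :: p) q) <= size p + size q)%N.
Proof.
elim: p u => [|v p IH] u //=.
by have := IH v; case: (step_size u v (act_walk (v :: p) q)) => /=; lia.
Qed.

(** Both paths are compared with the normal form of one walk [s]. By induction on [s], its first
    edge is transferred to the reduced path [r]; in the end [r] is closed, hence null-homotopic,
    hence trivial. *)
Lemma reduced_uniq x y p q : edge_path x p y -> reduced x p ->
  edge_path x q y -> reduced x q -> path_equiv x p q.
Proof.
suff main r s z w : edge_path z s w -> edge_path z r w -> reduced z r ->
    path_equiv z (act_walk (z :: s) [::]) r.
  move=> ep rp eq rq; apply: (path_equiv_trans flag).
    exact/path_equiv_sym/(main _ _ _ _ ep ep rp).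
  exact: main ep eq rq.
elim: s z r => [|v s IH] z r.
  move=> /= -> er rr; have /(homotopic_act w)[_ _ H] := proj2 (proj1 hX) _ _ er.
  have := H [::] I => /= /path_equiv_sym h.
  exact: (path_equiv_trans flag h (act_walk_nil rr)).
move=> /= [zv sw] er rr; have vz := edge_sym zv.
have e := IH _ _ sw (step_edge_path vz er) (step_reduced flag v rr).
exact: (path_equiv_trans flag (step_equiv flag z e) (step_back flag v rr)).
Qed.

Lemma reduced_exists x y : exists2 p, edge_path x p y & reduced x p.
Proof.
have [p ep] := proj1 (proj1 hX) x y.
exists (act_walk (x :: p) [::]); first exact: act_walk_edge_path ep _.
exact: (@act_walk_reduced x (x :: p)).
Qed.

Lemma reduced_size x y p q : edge_path x p y -> reduced x p ->
  edge_path x q y -> (size p <= size q)%N.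
Proof.
move=> ep rp eq; pose q' := act_walk (x :: q) [::].
have eq' : edge_path x q' y by exact: act_walk_edge_path eq _.
have rq' : reduced x q' by exact: (@act_walk_reduced x (x :: q)).
rewrite (path_equiv_size (reduced_uniq ep rp eq' rq')).
by have := act_walk_size x q [::]; rewrite addn0.
Qed.

Lemma dist_reduced x y p : edge_path x p y -> reduced x p -> dist x y = size p.
Proof.
move=> ep rp; apply: xget_subset1 => [|m n [[q eq <-] hq] [[r er <-] hr]].
  by split; [exists p|move=> q; apply: reduced_size].
by apply/eqP; rewrite eqn_leq hq // hr.
Qed.

Lemma dist_le x y p : edge_path x p y -> (dist x y <= size p)%N.
Proof.
have [q eq rq] := reduced_exists x y.
by rewrite (dist_reduced eq rq); apply: reduced_size.
Qed.

Lemma geodesic_exists x y : exists2 p, edge_path x p y & size p = dist x y.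
Proof.
by have [p ep rp] := reduced_exists x y; exists p; rewrite // (dist_reduced ep).
Qed.

Lemma edge_path_rcons x p y z :
  edge_path x p y -> edge y z -> edge_path x (rcons p z) z.
Proof. by elim: p x => [|v p IH] x /= => [->|[xv /IH h] /h]. Qed.

Lemma edge_path_rev x p y :
  edge_path x p y -> exists2 q, edge_path y q x & size q = size p.
Proof.
elim: p x => [|v p IH] x /=; first by move=> ->; exists [::].
move=> [/edge_sym vx /IH[q eq <-]]; exists (rcons q x).
  exact: edge_path_rcons eq vx.
by rewrite size_rcons.
Qed.

Lemma dist_sym x y : dist x y = dist y x.
Proof.
suff le u v : (dist u v <= dist v u)%N by apply/eqP; rewrite eqn_leq !le.
have [p /edge_path_rev[q eq <-] <-] := geodesic_exists v u.
exact: dist_le.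
Qed.

Lemma distxx x : dist x x = 0%N.
Proof. exact: (@dist_reduced x x [::]). Qed.

Lemma dist_eq0 x y : dist x y = 0%N -> x = y.
Proof. by have [[|? p] ep <-] := geodesic_exists x y. Qed.

Lemma dist_closer x y n : dist x y = n.+1 ->
  exists2 z, edge x z & dist z y = n.
Proof.
have [p ep rp] := reduced_exists x y; rewrite (dist_reduced ep rp).
case: p ep rp => [|z p] // [xz ep] [rp _] [<-]; exists z => //.
exact: dist_reduced.
Qed.

(** The 1-skeleton is bipartite, because [step] changes the length of a reduced path by exactly
    one. *)
Lemma dist_edge u v y : edge u v ->
  dist u y = (dist v y).+1 \/ dist v y = (dist u y).+1.
Proof.
move=> uv; have [p ep rp] := reduced_exists v y.
rewrite (dist_reduced ep rp) (dist_reduced (step_edge_path uv ep)).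
  exact: step_size.
exact: step_reduced.
Qed.

(** The quadrangle condition of median graphs: geodesics through [a] and [b] are reduced, hence
    equivalent, and comparing their first steps yields the square. *)
Lemma quadrangle y v a b : edge v a -> edge v b -> a <> b ->
  dist v y = (dist a y).+1 -> dist v y = (dist b y).+1 ->
  exists2 c, square v a c b & dist v y = (dist c y).+2.
Proof.
have geo w : edge v w -> dist v y = (dist w y).+1 ->
    exists p, edge_path v (w :: p) y /\ reduced v (w :: p).
  move=> vw vy; have [p ep rp] := reduced_exists w y; exists p; split=> //.
  (* A backtrack would leave a path from [v] to [y] shorter than their distance. *)
  split=> // r e; have := path_equiv_size e.
  have [_ er] := proj1 (path_equiv_edge y e) ep.
  by have := dist_le er; rewrite vy (dist_reduced ep rp) /=; lia.
move=> va vb ab da db; have [p [ep rp]] := geo a va da.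
have [q [eq rq]] := geo b vb db.
have /path_equiv_consP[[]//|[_ [c [r [sq e _]]]]] := reduced_uniq ep rp eq rq.
exists c => //; rewrite da.
have [_ ec] := proj1 (path_equiv_edge y e) (proj2 ep).
have [rc _] := proj1 (reduced_equiv flag e) (proj1 rp).
rewrite (dist_reduced ec rc) (dist_reduced (proj2 ep) (proj1 rp)).
by rewrite (path_equiv_size e).
Qed.

End Geodesics.

(** * Halfspaces *)

Section Halfspaces.
Variable X : cube_complex.
Implicit Types (a b c u v x y z : X) (h k : set X).
Hypothesis hX : CAT0 X.

Definition side a b : set X := [set v | (dist v a < dist v b)%N].

Lemma dist_edge_r v a b : edge a b ->
  dist v a = (dist v b).+1 \/ dist v b = (dist v a).+1.
Proof.
by move=> ab; rewrite (dist_sym hX v a) (dist_sym hX v b); apply: dist_edge.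
Qed.

Lemma sideN a b v : edge a b -> ~ side a b v <-> side b a v.
Proof. by move=> /(dist_edge_r v); rewrite /side /=; split; lia. Qed.

Lemma side_square a b c d : square a b c d -> side a b = side d c.
Proof.
suff sub (e f g i : X) : square e f g i -> side e f `<=` side i g.
  move=> sq; apply/seteqP; split; apply: sub => //.
  exact: square_rot (square_flip sq).
move=> sq v ev.
have e1 := square_edge sq; have e2 := square_edge (square_rot sq).
have e3 := square_edge (square_rot (square_rot sq)).
have e4 := square_edge (square_flip sq).
apply: contrapT => /(sideN _ (edge_sym e3)).
move: ev; rewrite /side /= => ev hg.
have [|||||k sk] := @quadrangle _ hX v f e g.
- exact: edge_sym.
- exact: e2.
- by case: (square_neq sq).
- move: (dist_edge_r v e1); rewrite (dist_sym hX f) (dist_sym hX e); lia.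
- move: (dist_edge_r v e1) (dist_edge_r v e2) (dist_edge_r v e3)
    (dist_edge_r v e4); rewrite (dist_sym hX f) (dist_sym hX g); lia.
rewrite (square_uniq sk (square_flip (square_rot sq))) !(dist_sym hX _ v).
move: (dist_edge_r v e1) (dist_edge_r v e2) (dist_edge_r v e3)
    (dist_edge_r v e4); lia.
Qed.

(* The edge from [u] to [w] is moved through squares onto the edge from [a] to
   [b]. *)
Lemma side_crossing a b u w : edge a b -> edge u w ->
  ~ side b a u -> side b a w -> side w u = side b a.
Proof.
move=> ab; have ba := edge_sym ab.
move E: (dist w b) => n; elim: n w u E => [|n IHn] w u E uw /(sideN _ ba).
all: rewrite {1 2}/side /= E => ua wa.
  have ub : dist u b = 1%N.
    by have := dist_edge hX b uw; rewrite E; lia.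
  by rewrite (dist_eq0 hX E) (@dist_eq0 _ hX u a) //; lia.
have [v wv vb] := dist_closer hX E.
move: (dist_edge_r u ab) (dist_edge_r w ab) (dist_edge hX a uw)
  (dist_edge hX b uw) => d1 d2 d3 d4.
have da : dist v a = n.+1.
  by move: (dist_edge_r v ab) (dist_edge hX a wv); lia.
have [|||c sq dc] := @quadrangle _ hX a w u v (edge_sym uw) wv.
- by move=> e; move: vb; rewrite -e; lia.
- lia.
- lia.
rewrite (side_square sq); have vc := square_edge (square_rot (square_rot sq)).
apply: (IHn v c vb vc); last by rewrite /side /=; lia.
apply/(sideN _ ba); rewrite /side /=; move: (dist_edge_r c ab)
  (dist_edge hX b (square_edge (square_rot sq))); lia.
Qed.

Lemma side_eq h u w : halfspace h -> edge u w -> ~ h u -> h w -> h = side w u.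
Proof.
by move=> [a [b [ab ->]]] uw hu hw; rewrite (side_crossing (edge_sym ab) uw).
Qed.

(** By [side_eq], each edge of a path from [x] to [y] enters at most one halfspace of the
    interval. *)
Lemma interval_finite x y : finite_set (Defs.interval x y).
Proof.
have [p] : exists p, edge_path x p y by exact: (proj1 (proj1 hX)).
elim: p x => [|v p IH] x /=.
  move=> ->; rewrite (_ : Defs.interval y y = set0) //.
  by apply/seteqP; split=> // h [_ hy /(_ hy)].
move=> [xv /IH fin].
apply: (@sub_finite_set _ _ (side v x |` Defs.interval v y)).
  move=> h [hh hy hx]; have [hv|hv] := pselect (h v); last by right.
  by left; apply: side_eq hh xv hx hv.
by rewrite finite_setU.
Qed.

(* Two consecutive edges of a geodesic towards [y] either span a square, which
   lets the second one be crossed first, or cross nested halfspaces. *)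
Lemma side_toward h v y : halfspace h -> h y -> ~ h v ->
  exists w, [/\ edge v w, dist v y = (dist w y).+1 & h `<=` side w v].
Proof.
move=> hh hy; move E: (dist v y) => n.
elim: n v E => [|n IHn] v E hv; first by rewrite (dist_eq0 hX E) in hv.
have [w vw dw] := dist_closer hX E.
have [hw|hw] := pselect (h w).
  by exists w; rewrite dw; split=> //; rewrite -(side_eq hh vw hv hw).
have [u [wu dwu hu]] := IHn w dw hw.
have [sub|/existsNP[t /not_implyP[ht /(sideN _ (edge_sym vw)) vt]]] :=
    pselect (h `<=` side w v).
  by exists w; rewrite dw.
(* The witness [t] is closer to both [v] and [u] than to [w], so these span a square at [w]; its
   fourth vertex [c] replaces [w]. *)
have := hu _ ht; move: vt; rewrite /side /= => vt ut.
have vu : v <> u by move=> e; move: dwu; rewrite -e E; lia.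
have [||c sq dc] := @quadrangle _ hX t w v u (edge_sym vw) wu vu.
- by move: (dist_edge_r t vw); rewrite !(dist_sym hX _ t); lia.
- by move: (dist_edge_r t wu); rewrite !(dist_sym hX _ t); lia.
have vc : edge v c := square_edge (square_rot sq).
have cu : edge c u := square_edge (square_rot (square_rot sq)).
exists c; split=> //; last first.
  by move: hu; rewrite (side_square (square_rot (square_rot (square_rot sq)))).
by move: (dist_edge hX y vc) (dist_edge hX y cu); lia.
Qed.

(* The cube is found at a vertex outside all [h i] that is closest to [y]. *)
Lemma antichain_cube n (h : 'I_n -> set X) x y :
  (forall i, Defs.interval x y (h i)) ->
  (forall i j, h i `<=` h j -> i = j) -> exists c : Q n -> X, cube c.
Proof.
move=> hxy anti.
pose P m := `[< exists2 v, dist v y = m & forall i, ~ h i v >].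
have exP : exists m, P m.
  by exists (dist x y); apply/asboolP; exists x => // i; case: (hxy i).
case: (ex_minnP exP) => m /asboolP[v vm hv] minv.
(* By minimality of [v], every edge from [v] towards [y] enters some [h i]. *)
have crossed w : edge v w -> dist v y = (dist w y).+1 ->
    exists i, h i = side w v.
  move=> vw vy; have [[i hi]|nh] := pselect (exists i, h i w).
    by exists i; apply: side_eq => //; case: (hxy i).
  have : (m <= dist w y)%N.
    apply: minv; apply/asboolP; exists w => // i hi; apply: nh; by exists i.
  by rewrite -vm vy ltnn.
have /choice[w hw] i : exists w,
    [/\ edge v w, dist v y = (dist w y).+1 & h i = side w v].
  have [hi hy _] := hxy i.
  have [w [vw vy sub]] := side_toward hi hy (hv i).
  (* The side containing [h i] is itself some [h j], so the antichain hypothesis turns inclusion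
     into equality. *)
  exists w; split=> //; have [j hj] := crossed w vw vy.
  by rewrite -hj; congr h; apply: anti; rewrite hj.
have [c kc _] : link_simplex v w; last by exists c.
apply: (proj2 hX) => [i|i j /eqP ij].
  by apply: edge_link_vertex; case: (hw i).
have [vi di hi] := hw i; have [vj dj hj] := hw j.
have wij : w i <> w j by move=> e; apply: ij; apply: anti; rewrite hi hj e.
have [c sq _] := quadrangle hX vi vj wij di dj.
exact: square_link_adjacent sq.
Qed.

(** * Automorphisms preserve distance, halfspaces and tight nesting *)

Section Action.
Variables (Gamma : groupType) (act : Gamma -> X -> X).
Hypothesis hact : acts_by_automorphisms act.

Lemma actK g : cancel (act g) (act g^-1%g).
Proof. by case: hact => a1 aM _ v; rewrite -aM mulVg a1. Qed.

Lemma actKV g : cancel (act g^-1%g) (act g).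
Proof. by move=> v; rewrite -{1}(invgK g) actK. Qed.

Lemma act_edge g a b : edge a b -> edge (act g a) (act g b).
Proof.
by case: hact => _ _ ac [c kc [<- <-]]; exists (act g \o c) => //; apply: ac.
Qed.

Lemma act_dist g x y : dist (act g x) (act g y) = dist x y.
Proof.
have le (i : Gamma) u v : (dist (act i u) (act i v) <= dist u v)%N.
  have [p ep <-] := geodesic_exists hX u v.
  have : edge_path (act i u) (map (act i) p) (act i v).
    elim: p u ep => [|w p IH] u /=; first by move=> ->.
    by move=> [/(act_edge i) uw /IH].
  by move/(dist_le hX); rewrite size_map.
apply/eqP; rewrite eqn_leq le /=.
by have := le g^-1%g (act g x) (act g y); rewrite !actK.
Qed.

Lemma act_halfspace g h : halfspace h -> halfspace (act g @` h).
Proof.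
move=> [a [b [ab ->]]]; exists (act g a), (act g b); split.
  exact: act_edge.
apply/seteqP; split=> [_ [v vab <-]|v vab] /=; first by rewrite !act_dist.
exists (act g^-1%g v); last exact: actKV.
by rewrite /side /= -(act_dist g) -(act_dist g _ b) !actKV.
Qed.

Lemma act_imageK g h : act g^-1%g @` (act g @` h) = h.
Proof.
rewrite image_comp; apply/seteqP; split=> [_ [v hv <-]|v hv] /=.
  by rewrite actK.
by exists v => //=; rewrite actK.
Qed.

Lemma act_imageKV g h : act g @` (act g^-1%g @` h) = h.
Proof. by have := act_imageK g^-1%g h; rewrite invgK. Qed.

Lemma act_tightly_nested g h k :
  tightly_nested h k -> tightly_nested (act g @` h) (act g @` k).
Proof.
have sub e f i : e `<=` f -> act i @` e `<=` act i @` f by apply: image_subset.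
move=> [[kh nhk] tight]; split=> [|h' hh' kh' h'h].
  split; first exact: sub.
  by move/(sub _ _ g^-1%g); rewrite !act_imageK.
have := tight _ (act_halfspace g^-1%g hh').
move: kh' h'h => /(sub _ _ g^-1%g) + /(sub _ _ g^-1%g).
rewrite !act_imageK => a b /(_ a b) => -[] <-; rewrite act_imageKV;
  by [left|right].
Qed.

End Action.
End Halfspaces.

(** * Counting segments *)

(** Elements without a predecessor in [s] form an antichain. Any chain among the others extends by a
    predecessor of its first element, so removing that antichain lowers the chain bound by one. *)
Lemma chain_antichain_bound (T : eqType) (lt : rel T) (m n : nat) (s : seq T) :
  uniq s ->
  (forall c, {subset c <= s} -> sorted lt c -> (size c <= m)%N) ->
  (forall A, uniq A -> {subset A <= s} -> {in A &, forall x y, ~~ lt x y} ->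
    (size A <= n)%N) ->
  (size s <= m * n)%N.
Proof.
elim: m s => [|m IHm] s us chain anti.
  case: s us chain {anti} => // x s _ /(_ [:: x]); rewrite /= ltnn => chain.
  by apply: chain => // y; rewrite !inE => ->.
pose dom x := has (fun y => lt y x) s.
rewrite -(count_predC dom) addnC mulSn -!size_filter; apply: leq_add.
  apply: anti => [||x y]; first exact: filter_uniq.
    by move=> x; rewrite mem_filter => /andP[].
  rewrite !mem_filter /= => /andP[_ xs] /andP[/hasPn ny ys]; exact: ny.
apply: IHm => [|c cs|A uA As]; first exact: filter_uniq.
- case: c cs => // x c cs xc.
  have := cs x (mem_head _ _); rewrite mem_filter => /andP[/hasP[y ys yx] _].
  apply: (chain [:: y, x & c]); last by rewrite /= yx.
  move=> z; rewrite inE => /predU1P[-> //|/cs].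
  by rewrite mem_filter => /andP[].
- by apply: anti => // x /As; rewrite mem_filter => /andP[].
Qed.

Lemma size_flatten_map (S T : eqType) (f : S -> seq T) (s : seq S) n :
  {in s, forall x, (size (f x) <= n)%N} ->
  (size (flatten (map f s)) <= size s * n)%N.
Proof.
elim: s => // x s IH fn; rewrite /= size_cat mulSn leq_add ?fn ?mem_head //.
by apply: IH => y ys; rewrite fn // inE ys orbT.
Qed.

Section Counting.
Variables (X : cube_complex) (d sigma : nat).
Hypotheses (hX : CAT0 X) (hd : has_dimension X d).
Hypothesis (hsigma : has_staircase_length X sigma).
Implicit Types (h k : set X).

Definition nonnested h k : bool := ~~ `[< h `<=` k >] && ~~ `[< k `<=` h >].

Lemma nonnestedI h k : ~ h `<=` k -> ~ k `<=` h -> nonnested h k.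
Proof. by move=> hk kh; apply/andP; split; apply/asboolPn. Qed.

Lemma nonnested_proper h k :
  ~ h `<` k -> ~ k `<` h -> h <> k -> nonnested h k.
Proof.
by move=> hk kh ne; apply: nonnestedI => sub;
  [apply: hk|apply: kh]; rewrite properEneq; split=> //; apply/eqP => // /esym.
Qed.

Lemma proper_trans h k (l : set X) : h `<` k -> k `<` l -> h `<` l.
Proof.
move=> [hk _] [kl nlk]; split=> [v /hk/kl //|lh].
by apply: nlk => v /lh/hk.
Qed.

Section Interval.
Variables x y : X.
Let P : seq (set X) := fset_set (Defs.interval x y).

Lemma mem_intervalP h : reflect (Defs.interval x y h) (h \in P).
Proof.
by rewrite in_fset_set ?inE; [apply: asboolP|apply: interval_finite].
Qed.

Lemma antichain_size (A : seq (set X)) :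
  {subset A <= P} -> pairwise nonnested A -> (size A <= d)%N.
Proof.
move=> AP /(pairwiseP set0) anti.
have [||c kc] := @antichain_cube X hX (size A) (fun i => nth set0 A i) x y.
- by move=> i; apply/mem_intervalP/AP/mem_nth.
- move=> i j sub; have [ij|ij|ij] := ltngtP i j; last exact: val_inj.
    have := anti _ _ (ltn_ord i) (ltn_ord j) ij.
    by case/andP => /asboolPn.
  have := anti _ _ (ltn_ord j) (ltn_ord i) ij.
  by case/andP => _ /asboolPn.
exact: (proj2 hd) kc.
Qed.

Definition tight h k : bool := `[< tightly_nested h k >].

Lemma antichain_size_in (A : seq (set X)) :
  uniq A -> {subset A <= P} -> {in A &, forall h k, h <> k -> nonnested h k} ->
  (size A <= d)%N.
Proof.
move=> uA AP anti; apply: antichain_size => //.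
move: uA; rewrite uniq_pairwise; apply: (@sub_in_pairwise _ (mem A)).
  by move=> h k hA kA /= /eqP; apply: anti.
exact/allP.
Qed.

(** If one of two halfspaces tightly below [h] contained the other, it would lie strictly between
    that one and [h]. *)
Lemma tight_size h : (size [seq k <- P | tight h k] <= d)%N.
Proof.
apply: antichain_size_in => [|k|k l]; first exact/filter_uniq/fset_uniq.
  by rewrite mem_filter => /andP[].
rewrite !mem_filter => /andP[/asboolP[[kh nhk] tk] /mem_intervalP[hk _ _]].
move=> /andP[/asboolP[[lh nhl] tl] /mem_intervalP[hl _ _]] kl.
apply: nonnestedI => sub.
  by case: (tk _ hl sub lh) => [e|/esym//]; apply: nhl; rewrite e.
by case: (tl _ hk sub kh) => // e; apply: nhk; rewrite e.
Qed.

Lemma tight_size_up h : (size [seq k <- P | tight k h] <= d)%N.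
Proof.
apply: antichain_size_in => [|k|k l]; first exact/filter_uniq/fset_uniq.
  by rewrite mem_filter => /andP[].
rewrite !mem_filter => /andP[/asboolP[[kh nhk] tk] /mem_intervalP[hk _ _]].
move=> /andP[/asboolP[[lh nhl] tl] /mem_intervalP[hl _ _]] kl.
apply: nonnestedI => sub.
  by case: (tl _ hk kh sub) => // e; apply: nhk; rewrite e.
by case: (tk _ hl lh sub) => [/esym//|e]; apply: nhl; rewrite e.
Qed.

(** The relation is a parameter so that segments can be continued downwards with [tight] and upwards
    with its converse. *)
Fixpoint extensions (r : rel (set X)) n h : seq (seq (set X)) :=
  if n is m.+1 then
    flatten [seq map (cons k) (extensions r m k) | k <- [seq k <- P | r h k]]
  else [:: [::]].

Lemma mem_extensions r h e :
  path r h e -> {subset e <= P} -> e \in extensions r (size e) h.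
Proof.
elim: e h => [|k e IH] h /=; first by rewrite inE.
move=> /andP[hk ke] eP; apply/flatten_mapP; exists k.
  by rewrite mem_filter hk eP ?mem_head.
by rewrite map_f // IH // => l le; rewrite eP // inE le orbT.
Qed.

Lemma size_extensions r n h :
  (forall k, (size [seq l <- P | r k l] <= d)%N) ->
  (size (extensions r n h) <= d ^ n)%N.
Proof.
move=> rd; elim: n h => //= n IH h; rewrite expnS.
apply: leq_trans (@size_flatten_map _ _ _ _ (d ^ n)%N _) _.
  by move=> k _; rewrite size_map.
by rewrite leq_mul2r rd orbT.
Qed.

(** * Tightly nested pairs split by a vertex, and the segments through them *)

Variable z : X.

Definition split_pairs : seq (set X * set X) :=
  [seq p <- allpairs pair P P |
    [&& tight p.1 p.2, `[< p.1 z >] & ~~ `[< p.2 z >]]].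

Lemma mem_split_pairsP a b : reflect
  [/\ Defs.interval x y a, Defs.interval x y b, tightly_nested a b, a z & ~ b z]
  ((a, b) \in split_pairs).
Proof.
rewrite mem_filter; apply: (iffP idP).
  move=> /andP[/and3P[/asboolP tab /asboolP az /asboolPn bz]].
  move=> /allpairsP[[a' b'] /= [/mem_intervalP aP /mem_intervalP bP [ea eb]]].
  by subst a' b'.
move=> [/mem_intervalP aP /mem_intervalP bP tab az bz].
rewrite allpairs_f //= andbT; apply/and3P.
by split; [apply/asboolP|apply/asboolP|apply/asboolPn].
Qed.

Definition lt_both (p q : set X * set X) := `[< q.1 `<` p.1 /\ q.2 `<` p.2 >].

Lemma lt_both_trans : transitive lt_both.
Proof.
move=> q p r /asboolP[pq1 pq2] /asboolP[qr1 qr2]; apply/asboolP.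
by split; [apply: proper_trans pq1|apply: proper_trans pq2].
Qed.

Lemma split_chain_size c :
  {subset c <= split_pairs} -> sorted lt_both c -> (size c <= sigma)%N.
Proof.
rewrite (sorted_pairwise lt_both_trans) => cT /(pairwiseP (set0, set0)) ord.
pose p (i : 'I_(size c)) := nth (set0, set0) c i.
have pT i : [/\ Defs.interval x y (p i).1, Defs.interval x y (p i).2,
    tightly_nested (p i).1 (p i).2, (p i).1 z & ~ (p i).2 z].
  by apply/mem_split_pairsP; rewrite -surjective_pairing; apply/cT/mem_nth.
have lt (i j : 'I_(size c)) : (i < j)%N ->
    (p j).1 `<` (p i).1 /\ (p j).2 `<` (p i).2.
  by move=> ij; apply/asboolP/(ord _ _ (ltn_ord i) (ltn_ord j) ij).
apply: (proj2 hsigma _ (fun i => (p i).1) (fun i => (p i).2)).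
split=> // [i|i j ji|i].
- by case: (pT i) => -[? _ _] [? _ _].
(* Three quadrants contain [y], [z] and [x]. If the fourth were empty, [(p i).1] would lie between
   [(p j).2] and [(p j).1]; tightness and properness would give [(p i).1 = (p j).2], but only the
   former contains [z]. *)
- have [[hi iy ix] _ _ iz _] := pT i.
  have [_ [hj jy jx] [jj tj] jz njz] := pT j; have [[sub nsub] _] := lt _ _ ji.
  split; [by exists y| |by exists z|by exists x].
  apply: contrapT => /nonemptyPn e.
  have ji' : (p j).2 `<=` (p i).1.
    move=> v vj; apply: contrapT => vi.
    by have : set0 v by rewrite -e.
  have [e'|e'] := tj _ hi ji' sub; first by apply: nsub; rewrite e'.
  by apply: njz; rewrite -e'.
- by case: (pT i) => _ _ [].
Qed.

Definition lt_first (p q : set X * set X) :=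
  `[< q.1 `<` p.1 >] || (p.1 == q.1) && (index p.2 P < index q.2 P)%N.

Lemma lt_first_trans : transitive lt_first.
Proof.
move=> q p r /orP[/asboolP pq|/andP[/eqP pq ipq]]
  /orP[/asboolP qr|/andP[/eqP qr iqr]]; apply/orP; [left|left|left|right].
- exact/asboolP/(proper_trans qr).
- by apply/asboolP; rewrite -qr.
- by apply/asboolP; rewrite pq.
- by rewrite pq qr eqxx (ltn_trans ipq iqr).
Qed.

(* [lt_first] breaks ties between pairs with the same first halfspace, so that
   its antichains have distinct first halfspaces; by tightness, its chains in
   [S] have pairwise non-nested second halfspaces. *)
Lemma split_antichain_size (S : seq (set X * set X)) : uniq S ->
  {subset S <= split_pairs} -> {in S &, forall p q, ~~ lt_both p q} ->
  (size S <= d * d)%N.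
Proof.
move=> uS ST anti.
apply: (chain_antichain_bound (lt := lt_first)) => // [c cS|A uA AS nlt].
- rewrite (sorted_pairwise lt_first_trans) => ord.
  rewrite -(size_map snd).
  apply: antichain_size => [_ /mapP[[a b] /cS/ST + ->]|].
    by case/mem_split_pairsP => _ /mem_intervalP.
  rewrite pairwise_map; move: ord.
  apply: (@sub_in_pairwise _ (mem c)); last exact/allP.
  move=> [a b] [a' b'] /cS pS /cS qS /=; rewrite /lt_first /=.
  have /mem_split_pairsP[[ha _ _] [hb _ _] [ba tab] _ _] := ST _ pS.
  have /mem_split_pairsP[[ha' _ _] [hb' _ _] [ba' tab'] _ _] := ST _ qS.
  move=> /orP[/asboolP a'a|/andP[/eqP aa' ij]].
    (* Proper inclusion of [b'] in [b] would make the pairs comparable for [lt_both]. Inclusion of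
       [b] in [b'] would place [a'] between [b] and [a], against tightness. *)
    have npq : ~ b' `<` b.
      by move=> b'b; have /negP := anti _ _ pS qS; apply; apply/asboolP.
    have nbb' : ~ b `<=` b'.
      move=> bb'; case: (tab a' ha') => [|||e].
      - by apply: subset_trans bb' _; case: ba'.
      - by case: a'a.
      - by move=> e; case: a'a; rewrite e.
      - by move: ba'; rewrite e => -[_]; apply.
    apply: nonnestedI => // b'b; apply: npq; split=> // bb'; exact: nbb'.
  subst a'; have nb : b <> b' by move=> e; rewrite e ltnn in ij.
  apply: nonnestedI => sub.
    case: (tab b' hb') => // [|e|/esym //]; first by case: ba'.
    by case: ba' => _; rewrite e; apply.
  case: (tab' b hb) => // [|e]; first by case: ba.
  by case: ba => _; rewrite e; apply.
- rewrite -(size_map fst).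
  apply: antichain_size => [_ /mapP[[a b] /AS/ST + ->]|].
    by case/mem_split_pairsP => /mem_intervalP.
  rewrite pairwise_map; move: uA; rewrite uniq_pairwise.
  apply: (@sub_in_pairwise _ (mem A)); last exact/allP.
  move=> [a b] [a' b'] pA qA /= ne.
  have /norP[/asboolPn npq /nandP npq'] := nlt _ _ pA qA.
  have /norP[/asboolPn nqp /nandP nqp'] := nlt _ _ qA pA.
  apply: nonnested_proper => //= aa'; move: npq' nqp' => /=.
  have /mem_split_pairsP[_ /mem_intervalP bP _ _ _] := ST _ (AS _ pA).
  have /mem_split_pairsP[_ /mem_intervalP bP' _ _ _] := ST _ (AS _ qA).
  (* With equal first halfspaces, incomparability gives [b] and [b'] the same index in the list of
     the interval, so the pairs coincide. *)
  rewrite aa' eqxx /= -!leqNgt => -[//|i1] [//|i2].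
  have e : index b P = index b' P by apply/eqP; rewrite eqn_leq i1 i2.
  by move/eqP: ne; apply; rewrite aa' -(nth_index set0 bP) e nth_index.
Qed.

Lemma split_pairs_size : (size split_pairs <= sigma * (d * d))%N.
Proof.
apply: (chain_antichain_bound (lt := lt_both)); last first.
- exact: split_antichain_size.
- exact: split_chain_size.
apply: filter_uniq; apply: allpairs_uniq; try exact: fset_uniq.
by move=> [a b] [a' b'] _ _ /= [-> ->].
Qed.

(** [i] is the number of halfspaces before the split pair. These are generated upwards from [p.1],
    hence the reversal. *)
Definition crossing_segments l : seq (seq (set X)) :=
  flatten [seq flatten [seq
      [seq rev u ++ [:: p.1, p.2 & v] |
        u <- extensions (fun h k => tight k h) i p.1,
        v <- extensions tight (l - 2 - i) p.2]
      | p <- split_pairs] | i <- iota 0 (l - 1)].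

Lemma crossing_segments_size l :
  (size (crossing_segments l) <= (l - 1) * sigma * d ^ l)%N.
Proof.
rewrite /crossing_segments -mulnA -{2}(size_iota 0 (l - 1)).
(* Since [i] ranges below [l - 1], [il] gives [l >= 2], and the truncated subtractions below are
   exact. *)
apply: size_flatten_map => i; rewrite mem_iota => il.
apply: leq_trans (@size_flatten_map _ _ _ _ (d ^ (l - 2))%N _) _.
  move=> p _; rewrite size_allpairs (_ : (l - 2) = i + (l - 2 - i))%N; last lia.
  rewrite expnD addKn; apply: leq_mul; apply: size_extensions.
    exact: tight_size_up.
  exact: tight_size.
have -> : (d ^ l = d * d * d ^ (l - 2))%N.
  by rewrite -mulnA -!expnS; congr (_ ^ _)%N; lia.
rewrite mulnA; apply: leq_mul => //; exact: split_pairs_size.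
Qed.

(** Along a decreasing segment, membership of [z] can only change from true to false. *)
Lemma split_segment (L : seq (set X)) : sorted tight L ->
  ~ (forall h, h \in L -> h z) -> ~ (forall h, h \in L -> ~ h z) ->
  exists u a b v, [/\ L = u ++ [:: a, b & v], a z & ~ b z].
Proof.
elim: L => [|h L IH]; first by move=> _; case.
case: L IH => [|k L] IH /=.
  move=> _ n1 n2; exfalso; have [hz|hz] := pselect (h z); [apply: n1|apply: n2];
    by move=> h'; rewrite inE => /eqP ->.
move=> /andP[/asboolP[[kh _] _] sL] n1 n2.
have [hz|hz] := pselect (h z).
  have [kz|kz] := pselect (k z); last by exists [::], h, k, L.
  have [|||u [a [b [v [-> az bz]]]]] := IH.
  - exact: sL.
  - by move=> all; apply: n1 => h'; rewrite inE => /predU1P[-> //|/all].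
  - by move=> /(_ _ (mem_head _ _)).
  - by exists (h :: u), a, b, v.
have kz : ~ k z by move=> /kh.
have [|||u [a [b [v [-> az bz]]]]] := IH.
- exact: sL.
- by move=> /(_ _ (mem_head _ _)).
- by move=> all; apply: n2 => h'; rewrite inE => /predU1P[-> //|/all].
- by exists (h :: u), a, b, v.
Qed.

Lemma mem_crossing_segments (L : seq (set X)) : sorted tight L ->
  {subset L <= P} -> ~ (forall h, h \in L -> h z) ->
  ~ (forall h, h \in L -> ~ h z) -> L \in crossing_segments (size L).
Proof.
move=> sL LP n1 n2; have [u [a [b [v [eL az bz]]]]] := split_segment sL n1 n2.
have szL : size L = (size u + (size v).+2)%N by rewrite eL size_cat.
apply/flatten_mapP; exists (size u); first by rewrite mem_iota szL; lia.
move: (size L) szL => n szn; move: LP sL; rewrite {}eL => LP sL.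
have aP : a \in P by apply: LP; rewrite mem_cat mem_head orbT.
have bP : b \in P by apply: LP; rewrite mem_cat !inE eqxx !orbT.
have uP : {subset rev u <= P}.
  by move=> h; rewrite mem_rev => hu; apply: LP; rewrite mem_cat hu.
have vP : {subset v <= P}.
  by move=> h hv; apply: LP; rewrite mem_cat !inE hv !orbT.
have /= /andP[/asboolP tab tbv] := (cat_sorted2 sL).2.
have tua : path (fun h k => tight k h) a (rev u).
  rewrite -cat_rcons in sL; have := (cat_sorted2 sL).1.
  by rewrite -[rcons u a]revK rev_sorted rev_rcons.
apply/flatten_mapP; exists (a, b).
  by apply/mem_split_pairsP; split=> //; apply/mem_intervalP.
apply/allpairsP; exists (rev u, v); rewrite /= revK; split=> //.
  by rewrite -(size_rev u); apply: mem_extensions.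
rewrite (_ : n - 2 - size u = size v)%N; last by rewrite szn; lia.
exact: mem_extensions.
Qed.

End Interval.
End Counting.

(** * Counting translates and bounding the coboundary *)

Lemma card_fset_setU (T : choiceType) (A B : set T) :
  finite_set A -> finite_set B -> A `&` B = set0 ->
  #|` fset_set (A `|` B)| = (#|` fset_set A| + #|` fset_set B|)%N.
Proof.
move=> fA fB AB.
by rewrite fset_setU // cardfsU -fset_setI // AB fset_set0 cardfs0 subn0.
Qed.

Section Translates.
Variables (X : cube_complex) (d sigma : nat).
Hypotheses (hX : CAT0 X) (hd : has_dimension X d).
Hypothesis (hsigma : has_staircase_length X sigma).
Variables (Gamma : groupType) (act : Gamma -> X -> X).
Hypothesis hact : acts_by_automorphisms act.
Variables (l : nat) (hl : (1 <= l)%N) (s : l.-tuple (set X)).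
Hypothesis hs : Hsegment s.

Lemma translates_in_finite x y : finite_set (translates_in act s x y).
Proof.
pose P : seq (set X) := fset_set (Defs.interval x y).
apply: (@sub_finite_set _ _
  (range (fun t : l.-tuple (seq_sub P) => [tuple of map val t]))).
  move=> t [_ tP].
  have tP' i : tnth t i \in P by apply/(mem_intervalP hX).
  exists [tuple SeqSub (tP' i) | i < l] => //.
  by apply/eq_from_tnth => i; rewrite tnth_map tnth_mktuple.
exact/finite_image/finite_finset.
Qed.

Lemma translate_tight g : sorted (@tight X) (translate act g s).
Proof.
apply/(sortedP set0) => i; rewrite size_tuple => il; apply/asboolP.
have [_ ht] := hs.
have li : (i < l)%N by exact: ltnW.
have := ht (Ordinal li) (Ordinal il) erefl.
move/(act_tightly_nested hX hact g).
by rewrite -!(tnth_map (fun h => act g @` h)) !(tnth_nth set0).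
Qed.

(** The part of the count for [x], [y] that also contributes to the count for [x], [z]; its symmetry
    in [y] and [z] produces the cancellation. *)
Definition translates_out x y z : set (l.-tuple (set X)) :=
  [set t | (exists g, t = translate act g s) /\
    forall i, [/\ halfspace (tnth t i), ~ tnth t i x, tnth t i y & tnth t i z]].

Definition translates_into x y z : set (l.-tuple (set X)) :=
  [set t | (exists g, t = translate act g s) /\
    forall i,
      [/\ halfspace (tnth t i), ~ tnth t i x, ~ tnth t i y & tnth t i z]].

Lemma translates_outC x y z : translates_out x y z = translates_out x z y.
Proof. by apply/seteqP; split=> t [gt ti]; split=> // i; case: (ti i). Qed.

Lemma translates_intoC x y z : translates_into x y z = translates_into y x z.
Proof. by apply/seteqP; split=> t [gt ti]; split=> // i; case: (ti i). Qed.

Lemma card_translates_in x y z : exists2 c : nat,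
  #|` fset_set (translates_in act s x y)| =
    (#|` fset_set (translates_out x y z)| +
     #|` fset_set (translates_into x z y)| + c)%N &
  (c <= (l - 1) * sigma * d ^ l)%N.
Proof.
set S := translates_in act s x y; have finS : finite_set S.
  exact: translates_in_finite.
set A := translates_out x y z; set B := translates_into x z y.
have AS : A `<=` S by move=> t [gt ti]; split=> // i; case: (ti i).
have BS : B `<=` S by move=> t [gt ti]; split=> // i; case: (ti i).
have finA : finite_set A by exact: sub_finite_set finS.
have finB : finite_set B by exact: sub_finite_set finS.
have finC : finite_set (S `\` (A `|` B)) by apply: sub_finite_set finS => t [].
exists #|` fset_set (S `\` (A `|` B))|.
  have eS : S = A `|` B `|` (S `\` (A `|` B)).
    by rewrite setDE setUIr setUv setIT; apply/esym/setUidr => t [/AS|/BS].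
  rewrite {1}eS card_fset_setU ?finite_setU // ?setDIK //.
  congr (_ + _)%N; rewrite card_fset_setU //.
  (* As [l >= 1], a translate has a first halfspace, which cannot both contain and avoid [z]. *)
  apply/seteqP; split=> // t [[_ ti] [_ ti']].
  by case: (ti (Ordinal hl)) => _ _ _ tz; case: (ti' (Ordinal hl)).
set C := S `\` (A `|` B).
rewrite -(size_map val).
apply: leq_trans (crossing_segments_size hX hd hsigma x y z l).
apply: uniq_leq_size => [|_ /mapP[t + ->]].
  by rewrite map_inj_uniq ?fset_uniq //; exact: val_inj.
rewrite in_fset_set // inE => -[[[g tg] tS] tAB].
have := @mem_crossing_segments X hX x y z t; rewrite size_tuple; apply.
- by rewrite tg; apply: translate_tight.
- by move=> h /tnthP[i ->]; apply/(mem_intervalP hX).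
- move=> allz; apply: tAB; left; split; first by exists g.
  by move=> i; case: (tS i) => hi iy ix; split=> //; exact: allz (mem_tnth i t).
- move=> allz; apply: tAB; right; split; first by exists g.
  by move=> i; case: (tS i) => hi iy ix; split=> //; exact: allz (mem_tnth i t).
Qed.

Lemma delta1_fseg_le (R : realType) (t : X * X * X) :
  `|delta1 (fseg act R s) t| <= (3 * (l - 1) * sigma * d ^ l)%:R.
Proof.
move: t => [[x y] z]; rewrite /delta1 /fseg.
have [c1 -> b1] := card_translates_in x y z.
have [c2 -> b2] := card_translates_in y x z.
have [c3 -> b3] := card_translates_in y z x.
have [c4 -> b4] := card_translates_in z y x.
have [c5 -> b5] := card_translates_in x z y.
have [c6 -> b6] := card_translates_in z x y.
(* After this normalisation the six counts on each side of the splits cancel in pairs. Three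
   remainders with sign plus and three with sign minus are left, each between 0 and [B]; this gives
   the factor 3. *)
rewrite (translates_outC y z) (translates_outC z y) (translates_outC x z).
rewrite (translates_intoC z x) (translates_intoC z y) (translates_intoC y x).
have -> : (3 * (l - 1) * sigma * d ^ l = 3 * ((l - 1) * sigma * d ^ l))%N.
  by rewrite !mulnA.
move: ((l - 1) * sigma * d ^ l)%N b1 b2 b3 b4 b5 b6 => B.
rewrite -!(ler_nat R) => b1 b2 b3 b4 b5 b6; rewrite natrM !natrD.
have pos n : 0 <= n%:R :> R by exact: ler0n.
move: (pos c1) (pos c2) (pos c3) (pos c4) (pos c5) (pos c6) => *.
by rewrite ler_norml; apply/andP; split; lra.
Qed.

End Translates.

Theorem proposition3p16 (R : realType) (X : cube_complex) (hX : CAT0 X)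
    (d sigma : nat) (hd : has_dimension X d)
    (hsigma : has_staircase_length X sigma)
    (Gamma : groupType) (act : Gamma -> X -> X)
    (hact : acts_by_automorphisms act)
    (l : nat) (hl : (1 <= l)%N)
    (s : l.-tuple (set X)) (hs : Hsegment s) :
  bounded_fun (delta1 (fseg act R s)) /\
  (supnorm (delta1 (fseg act R s)) <= (3 * (l - 1) * sigma * d ^ l)%:R%:E)%E.
Proof.
have bound := delta1_fseg_le hX hd hsigma hact hl hs R.
split; last by apply: ge_ereal_sup => _ [t _ <-]; rewrite lee_fin.
exists (3 * (l - 1) * sigma * d ^ l)%:R; split; first exact: num_real.
by move=> M /ltW ltM t _; apply: le_trans ltM.
Qed.
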